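(* Let $K$ be a field, $S=K[x_1,\ldots,x_n]$, and let $I\subset S$ be a monomial ideal with $\dim S/I=0$. The ideal $L(I)\subset S^\wp$ generated by the monomials $x_{1,a_1+1}\cdots x_{n,a_n+1}$ with $x_1^{a_1}\cdots x_n^{a_n}\in\operatorname{Mon}(S\setminus I)$ has a linear resolution.
   Context: $\operatorname{Mon}(S\setminus I)$ is the (finite) set of monomials of $S$ not belonging to $I$. For $i=1,\ldots,n$ let $b_i\ge 1$ be the smallest integer with $x_i^{b_i}\in I$ (it exists since $\dim S/I=0$). $S^\wp$ is the standard graded polynomial ring over $K$ in the variables $x_{i,j}$, $1\le i\le n$, $1\le j\le b_i$. A graded ideal $J$ generated in a single degree $d$ has a linear resolution if its graded Betti numbers satisfy $\beta_{i,i+j}(J)=0$ for all $i$ and all $j\neq d$. *)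

(* Defs.v *)
(* MathComp + multinomials; {mpoly K[n]} is K[x_0, ..., x_(n-1)]. *)
From HB Require Import structures.
From mathcomp Require Import all_boot all_order all_algebra.
From mathcomp Require Export mpoly.
From Stdlib Require Import ClassicalEpsilon.

Set Implicit Arguments.
Unset Strict Implicit.
Unset Printing Implicit Defensive.

Import GRing.Theory.
Local Open Scope ring_scope.

(* Ideals are Prop-valued predicates: no decidability of membership is built
   in. *)
Section Ideals.
Variable A : comNzRingType.
Implicit Types (I P G : A -> Prop).

Definition is_ideal I : Prop :=
  I 0 /\ forall a x y, I x -> I y -> I (a * x + y).

Definition ideal_gen G (x : A) : Prop :=
  exists k (c g : 'I_k -> A), (forall i, G (g i)) /\ x = \sum_i c i * g i.

Definition prime_ideal P : Prop :=
  [/\ is_ideal P, ~ P 1 & forall x y, P (x * y) -> P x \/ P y].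

(* Primes of A / I are identified with primes of A containing I; only
   C 0, ..., C l matter. *)
Definition prime_chain I (l : nat) (C : nat -> A -> Prop) : Prop :=
  (forall k, (k <= l)%N ->
     prime_ideal (C k) /\ (forall x, I x -> C k x)) /\
  (forall k, (k < l)%N ->
     (forall x, C k x -> C k.+1 x) /\ exists x, C k.+1 x /\ ~ C k x).

(* dim A / I = d; in particular A / I is not the zero ring. *)
Definition quotient_krull_dim I (d : nat) : Prop :=
  (exists C, prime_chain I d C) /\
  (forall l C, prime_chain I l C -> (l <= d)%N).

End Ideals.

Section PolynomialIdeals.
Variables (K : fieldType) (n : nat).
Local Notation S := {mpoly K[n]}.
Implicit Types (I J : S -> Prop).

Definition monomial_ideal I : Prop :=
  exists M : 'X_{1..n} -> Prop,
    forall p, I p <-> ideal_gen (fun q => exists2 m, M m & q = 'X_[m]) p.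

Definition irrelevant_ideal : S -> Prop :=
  ideal_gen (fun q => exists i : 'I_n, q = 'X_i).

Definition generated_in_degree J (d : nat) : Prop :=
  exists G : S -> Prop,
    (forall q, G q -> q \is d.-homog) /\
    (forall p, J p <-> ideal_gen G p).

(* Data of a sequence ... -> F_1 -> F_0 -> S of graded free modules, with
   F_i = \bigoplus_(k < gf_rank i) S(- gf_shift i k).  Elements are row
   vectors, and maps act by right multiplication. *)
Record graded_free_seq := GradedFreeSeq {
  gf_rank : nat -> nat;
  gf_shift : forall i, 'I_(gf_rank i) -> nat;
  gf_aug : 'cV[S]_(gf_rank 0);
  gf_diff : forall i, 'M[S]_(gf_rank i.+1, gf_rank i)
}.

(* The maps are homogeneous of degree 0: an entry S(-a) -> S(-b) is a form of
   degree a - b, hence zero when a < b. *)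
Definition gf_homogeneous (F : graded_free_seq) : Prop :=
  (forall k, gf_aug F k ord0 \is (gf_shift k).-homog) /\
  (forall i k l, gf_diff F i k l = 0 \/
     exists2 e, gf_shift k = (gf_shift l + e)%N
              & gf_diff F i k l \is e.-homog).

Definition gf_resolves (F : graded_free_seq) J : Prop :=
  [/\ forall p, J p <-> exists v : 'rV_(gf_rank F 0), (v *m gf_aug F) ord0 ord0 = p,
      forall v : 'rV_(gf_rank F 0),
        v *m gf_aug F = 0 <-> exists w, v = w *m gf_diff F 0
    & forall i (v : 'rV_(gf_rank F i.+1)),
        v *m gf_diff F i = 0 <-> exists w, v = w *m gf_diff F i.+1].

Definition gf_minimal (F : graded_free_seq) : Prop :=
  forall i k l, irrelevant_ideal (gf_diff F i k l).

Definition minimal_graded_free_resolution (F : graded_free_seq) J : Prop :=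
  [/\ gf_homogeneous F, gf_resolves F J & gf_minimal F].

(* graded_betti J i j b means beta_{i,j}(J) = b: b is the multiplicity of
   S(-j) in F_i for the minimal graded free resolution F of J, which is unique
   up to isomorphism. *)
Definition graded_betti J (i j b : nat) : Prop :=
  exists2 F, minimal_graded_free_resolution F J
           & b = #|[set k : 'I_(gf_rank F i) | gf_shift k == j]|.

(* k is the internal degree, so beta_{i,k} is beta_{i,i+j} with j = k - i;
   letting k vary covers all integers j, negative ones included. *)
Definition has_linear_resolution J : Prop :=
  exists2 d, generated_in_degree J d
           & forall i k : nat, k <> (i + d)%N -> graded_betti J i k 0.

Definition is_pure_exponent I (i : 'I_n) (b : nat) : Prop :=
  [/\ (0 < b)%N, I ('X_i ^+ b)
    & forall c, (0 < c)%N -> I ('X_i ^+ c) -> (b <= c)%N].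

(* The smallest b >= 1 with 'X_i ^+ b in I (unspecified if there is none). *)
Definition pure_exponent I (i : 'I_n) : nat :=
  epsilon (inhabits 0%N) (is_pure_exponent I i).

(* Index set of the variables of S^wp.  The second component is 0-based:
   Tagged _ j stands for x_{i,j+1}, where i is the type index of j. *)
Definition wp_index I : finType := {i : 'I_n & 'I_(pure_exponent I i)}.

Definition wp_nvars I : nat := #|wp_index I|.

Definition wp_var I (i : 'I_n) (j : 'I_(pure_exponent I i)) :
    {mpoly K[wp_nvars I]} :=
  'X_(enum_rank (Tagged (fun i => 'I_(pure_exponent I i)) j : wp_index I)).

(* The bounds a i < b_i are automatic for 'X_[a] outside I; they are only used
   to form the 0-based index of x_{i,a_i+1}. *)
Definition L_ideal I : {mpoly K[wp_nvars I]} -> Prop :=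
  ideal_gen (fun q =>
    exists (a : 'X_{1..n}) (lt_ab : forall i, (a i < pure_exponent I i)%N),
      ~ I 'X_[a] /\ q = \prod_i wp_var (Ordinal (lt_ab i))).

End PolynomialIdeals.

Arguments L_ideal {K n} I _.

(* Main.v *)
(* L(I) is resolved by a polyhedral cell complex.  View a set T of variables
   x_{i,j} meeting every fibre {x_{i,1}, x_{i,2}, ...} as a product of n
   simplices; its vertices are the transversals of T, i.e. exponent vectors a.
   Let X be the complex of those T all of whose vertices lie in
   Mon(S \ I), which is closed under divisibility.  With F_p free on the T in X
   with |T| = n + p, the differential e_T |-> \sum_t +- x_t e_{T \ t} (over the
   t with T \ t in X) has only linear entries; with the augmentation
   e_T |-> \prod_{t in T} x_t, it remains to see exactness.  In multidegree m, with
   support W, this is acyclicity of the subcomplex {T in X | T \subset W} over K: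
   replacing the element of a fibre by the smallest element of W in that
   fibre stays in X because Mon(S \ I) is closed under divisibility, so the
   complex can be contracted fibre by fibre to a single vertex. *)
Require Import Defs.
From mathcomp Require Import all_boot all_order all_algebra.
From mathcomp Require Import ring.
From Stdlib Require Import ClassicalEpsilon.

Set Implicit Arguments.
Unset Strict Implicit.
Unset Printing Implicit Defensive.

Import GRing.Theory.
Local Open Scope ring_scope.

(** * Signs and the boundary operator *)

Section Differential.
Variables (V : finType) (n : nat) (fib : V -> 'I_n) (lev : V -> nat).
Hypothesis fib_lev_inj : forall s t, fib s = fib t -> lev s = lev t -> s = t.

(* Fibres are intervals for this order: in a 1-cell the two elements of the same
   fibre are then adjacent, so they get opposite signs and the augmentation needs
   none. *)
Definition before (s t : V) : bool :=
  (fib s < fib t)%N || (fib s == fib t) && (lev s < lev t)%N.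

Lemma before_irr t : before t t = false.
Proof. by rewrite /before !ltnn andbF. Qed.

Lemma before_asym s t : s != t -> before s t = ~~ before t s.
Proof.
move=> st; rewrite /before -[fib t == _]val_eqE -[fib s == _]val_eqE /=.
case: (ltngtP (fib s) (fib t)) => //= /val_inj e.
case: (ltngtP (lev s) (lev t)) => // e2.
by rewrite (fib_lev_inj e e2) eqxx in st.
Qed.

Section Koszul.
Variable A : comNzRingType.
Implicit Types (T : {set V}) (u : {set V} -> A).

Definition incidence (t : V) T : A := (-1) ^+ #|[set s in T | before s t]|.

Lemma incidence_sqr t T : incidence t T * incidence t T = 1.
Proof. by rewrite /incidence -expr2 sqrr_sign. Qed.

Lemma incidenceU s t T : s \notin T ->
  incidence t (s |: T) = (-1) ^+ before s t * incidence t T.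
Proof.
move=> sT; rewrite /incidence.
case b: (before s t).
- have -> : [set x in s |: T | before x t] = s |: [set x in T | before x t].
    by apply/setP => x; rewrite !inE andb_orl; case: eqP => // ->; rewrite b.
  by rewrite cardsU1 inE (negbTE sT) /= exprD.
- rewrite expr0 mul1r; congr (_ ^+ #|pred_of_set _|); apply/setP => x.
  by rewrite !inE; case: eqP => // ->; rewrite b (negbTE sT).
Qed.

Lemma incidence_anticomm s t T : s != t -> s \notin T -> t \notin T ->
  incidence t (s |: T) * incidence s (t |: T) = - (incidence t T * incidence s T).
Proof.
move=> st sT tT; rewrite !incidenceU // (before_asym st).
by case: (before t s); rewrite /= ?expr0 ?expr1; ring.
Qed.

Lemma incidence_anticomm2 s t T : s != t -> s \notin T -> t \notin T ->
  incidence t T * incidence s (t |: T) = - (incidence s T * incidence t (s |: T)).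
Proof.
move=> st sT tT; rewrite !incidenceU // (before_asym st).
by case: (before t s); rewrite /= ?expr0 ?expr1; ring.
Qed.

(** The boundary in the full simplex on [V], read off at the coefficient of [T]; truncation to a
    subcomplex is left to later lemmas. *)
Definition koszul u T : A := \sum_(t | t \notin T) incidence t T * u (t |: T).

(** Off-diagonal terms cancel in pairs, split by [before]. The diagonal is a separate assumption
    because antisymmetry does not kill it in characteristic 2. *)
Lemma sum_antisym (G : V -> V -> A) :
  (forall s t, s != t -> G s t = - G t s) -> (forall t, G t t = 0) ->
  \sum_s \sum_t G s t = 0.
Proof.
move=> anti diag.
have -> : \sum_s \sum_t G s t = \sum_s \sum_(t | before s t) G s t
                              + \sum_s \sum_(t | before t s) G s t.
  rewrite -big_split /=; apply: eq_bigr => s _.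
  rewrite (bigID (before s)) /=; congr (_ + _).
  rewrite (bigD1 s) ?before_irr //= diag add0r; apply: eq_bigl => t.
  have [->|ts] := eqVneq t s; first by rewrite before_irr andbF.
  by rewrite andbT [RHS]before_asym.
rewrite [X in _ + X](exchange_big_dep xpredT) //= -big_split /=.
rewrite big1 // => s _; rewrite -big_split big1 //= => t b.
rewrite [G s t]anti ?addNr //; apply: contraTneq b => ->.
by rewrite before_irr.
Qed.

Lemma koszul_koszul u T : koszul (koszul u) T = 0.
Proof.
rewrite /koszul.
pose G t s := if [&& t \notin T, s \notin T & s != t] then
  incidence t T * incidence s (t |: T) * u (s |: (t |: T)) else 0.
transitivity (\sum_t \sum_s G t s).
  rewrite [LHS]big_mkcond; apply: eq_bigr => t _; rewrite /G.
  case: ifP => tT /=; last by rewrite big1.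
  rewrite mulr_sumr [RHS]big_mkcond /= [LHS]big_mkcond; apply: eq_bigr => s _.
  rewrite !inE negb_or andbC mulrA; by case: ifP.
apply: sum_antisym => [s t st|t]; last by rewrite /G eqxx !andbF.
rewrite /G [t == s]eq_sym st !andbT [(t \notin T) && _]andbC.
case: ifP => [/andP[sT tT]|]; last by rewrite oppr0.
rewrite incidence_anticomm2 1?eq_sym // mulNr; congr (- (_ * u _)).
by rewrite setUCA.
Qed.

Lemma koszulD u v T : koszul (fun S => u S + v S) T = koszul u T + koszul v T.
Proof. by rewrite /koszul -big_split; apply: eq_bigr => t _; rewrite mulrDr. Qed.

Lemma koszulB u v T : koszul (fun S => u S - v S) T = koszul u T - koszul v T.
Proof. by rewrite /koszul -sumrB; apply: eq_bigr => t _; rewrite mulrBr. Qed.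

Lemma eq_koszul u v T : (forall t, t \notin T -> u (t |: T) = v (t |: T)) ->
  koszul u T = koszul v T.
Proof. by move=> e; apply: eq_bigr => t tT; rewrite e. Qed.

Lemma koszul_neq0 u T : koszul u T != 0 ->
  exists2 t, t \notin T & u (t |: T) != 0.
Proof.
move=> nz; have [/existsP[t /andP[]]|] :=
    boolP [exists t, (t \notin T) && (u (t |: T) != 0)]; first by exists t.
rewrite negb_exists => /forallP h; case/eqP: nz; apply: big1 => t tT.
by have := h t; rewrite tT /= negbK => /eqP ->; rewrite mulr0.
Qed.

End Koszul.

(** * Chains on a complex of sets meeting every fibre *)

Variable X : pred {set V}.
Hypothesis X_meets : forall T : {set V}, X T -> forall i, exists2 t, t \in T & fib t = i.
Hypothesis X_sub : forall S T : {set V}, X T -> S \subset T ->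
  (forall i, exists2 t, t \in S & fib t = i) -> X S.
Hypothesis X_down : forall (T : {set V}) t w, X T -> t \in T -> fib w = fib t ->
  (lev w <= lev t)%N -> X (w |: T).

(** A product of [n] simplices whose factors have [#|T|] vertices in total has dimension
    [#|T| - n]. *)
Definition cell p (T : {set V}) := X T && (#|T| == n + p)%N.

Lemma X_between (R S T : {set V}) : X R -> X T -> R \subset S -> S \subset T -> X S.
Proof.
move=> XR XT RS ST; apply: (X_sub XT ST) => i.
by have [t tR ti] := X_meets XR i; exists t => //; apply: (subsetP RS).
Qed.

Lemma fib_imset (T : {set V}) : X T -> fib @: T = [set: 'I_n].
Proof.
move=> XT; apply/setP => i; rewrite inE; apply/imsetP.
by have [t tT <-] := X_meets XT i; exists t.
Qed.

Lemma card_X (T : {set V}) : X T -> (n <= #|T|)%N.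
Proof.
move=> XT; rewrite -[n in (n <= _)%N]card_ord -cardsT -(fib_imset XT).
exact: leq_imset_card.
Qed.

Lemma cell0_inj (T : {set V}) : cell 0 T -> {in T &, injective fib}.
Proof.
case/andP => XT; rewrite addn0 => /eqP cT; apply/imset_injP.
by rewrite fib_imset // cardsT card_ord cT.
Qed.

Section Chains.
Variable A : comNzRingType.
Implicit Types (T W : {set V}) (u f g : {set V} -> A).

Definition chain p u := forall T, u T != 0 -> cell p T.

(** By counting, exactly one fibre of [T] has two elements [a] and [b], and only their removal
    leaves every fibre met. They are adjacent for [before], so the two signs cancel. *)
Lemma sum_incidence_cell1 T : cell 1 T ->
  \sum_(t in T | X (T :\ t)) incidence A t (T :\ t) = 0.
Proof.
case/andP => XT; rewrite addn1 => /eqP cT.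
have /dinjectivePn[a aT [b]] : ~~ dinjectiveb fib T.
  apply/negP => /dinjectiveP/card_in_imset.
  by rewrite fib_imset // cardsT card_ord cT => /eqP; rewrite eqn_leq ltnn andbF.
rewrite inE /= => /andP[ba bT] eab.
wlog ab : a b aT bT ba eab / before a b.
  move=> th; case ab: (before a b); first exact: (th a b).
  by apply: (th b a) => //; rewrite 1?eq_sym // before_asym // ab.
have remX c d : c \in T -> d \in T -> c != d -> fib c = fib d -> X (T :\ c).
  move=> cT' dT cd ecd; apply: (X_sub XT (subD1set _ _)) => i.
  have [t tT ti] := X_meets XT i; have [tc|tc] := eqVneq t c.
    by exists d; [rewrite !inE eq_sym cd | rewrite -ecd -tc].
  by exists t => //; rewrite !inE tc tT.
have remC c : c \in T -> X (T :\ c) -> cell 0 (T :\ c).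
  by rewrite /cell addn0 -eqSS -cT (cardsD1 c T) => -> ->; rewrite eqxx.
have Xa : X (T :\ a) by apply: (remX a b); rewrite 1?eq_sym.
have Xb : X (T :\ b) by apply: (remX b a).
rewrite (bigD1 a) ?aT //= (bigD1 b) ?bT ?Xb ?ba //= big1 ?addr0; last first.
  move=> c /andP[/andP[/andP[cT' Xc] ca] cb].
  have /(_ a b) := cell0_inj (remC _ cT' Xc).
  rewrite !inE aT bT ![_ == c]eq_sym ca cb => /(_ isT isT eab) e.
  by rewrite e eqxx in ba.
rewrite /incidence.
have -> : [set s in T :\ b | before s b] = a |: [set s in T :\ a | before s a].
  apply/setP => s; rewrite !inE; have [->|sa] /= := eqVneq s a.
    by rewrite eq_sym ba aT ab.
  have [->|sb] /= := eqVneq s b.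
    by rewrite (before_asym ba) ab andbF.
  case sT: (s \in T) => //=; rewrite /before eab.
  case: eqP => //= e; have /(_ s a) := cell0_inj (remC _ bT Xb).
  by rewrite !inE sT sb aT eq_sym ba e eab => /(_ isT isT erefl) e2;
    rewrite e2 eqxx in sa.
by rewrite cardsU1 !inE eqxx /= exprS mulN1r addrN.
Qed.

(** After exchanging the sums, each [u T] is multiplied by the signed count of the endpoints of the
    edge [T], which is zero. *)
Lemma sum_koszul_chain1 u : chain 1 u -> \sum_(T | cell 0 T) koszul u T = 0.
Proof.
move=> cu; rewrite /koszul (exchange_big_dep xpredT) //=.
transitivity (\sum_t \sum_(T : {set V} | (t \in T) && cell 0 (T :\ t))
    incidence A t (T :\ t) * u T).
  apply: eq_bigr => t _.
  rewrite (reindex_onto (fun T : {set V} => T :\ t) (fun T => t |: T)) /=; last first.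
    by move=> T /andP[_ tT]; rewrite setU1K.
  apply: eq_big => [T|T /andP[_ /eqP ->] //].
  rewrite !inE eqxx andbT andbC; case tT: (t \in T) => /=.
    by rewrite setD1K ?eqxx.
  by apply/andP => -[/eqP e]; rewrite -e !inE eqxx in tT.
rewrite (exchange_big_dep xpredT) //= big1 // => T _.
rewrite -mulr_suml; have [->|/cu cT] := eqVneq (u T) 0; first by rewrite mulr0.
rewrite -[RHS](mul0r (u T)) -[X in _ = X * _](sum_incidence_cell1 cT).
congr (_ * _).
apply: eq_bigl => t; case tT: (t \in T) => //=; rewrite /cell addn0.
case/andP: cT => _; rewrite addn1 (cardsD1 t) tT eqSS => ->.
by rewrite andbT.
Qed.

(** A nonzero boundary coefficient puts [t |: T] between [T] and a cell of [u], hence in [X]. This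
    makes truncation to [X] harmless. *)
Lemma koszul_X_face p u T t : chain p u -> X T ->
  koszul u (t |: T) != 0 -> X (t |: T).
Proof.
move=> cu XT /koszul_neq0[s sT /cu/andP[Xs _]].
by exact: (X_between XT Xs (subsetUr _ _) (subsetUr _ _)).
Qed.

(** * Contraction inside [W], fibre by fibre *)

Section Exactness.
Variable W : {set V}.

Definition chain_in p u := forall T, u T != 0 -> cell p T && (T \subset W).

Variable w : 'I_n -> V.
Hypothesis w_W : forall i, w i \in W.
Hypothesis fib_w : forall i, fib (w i) = i.
Hypothesis lev_w : forall t, t \in W -> (lev (w (fib t)) <= lev t)%N.

Definition contracted k (T : {set V}) :=
  [forall t in T, (fib t < k)%N ==> (t == w (fib t))].

Definition cone (k : 'I_n) u T : A :=
  if w k \in T then incidence A (w k) (T :\ w k) * u (T :\ w k) else 0.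

(** The cell [T :\ w k] has an element [t] in fibre [k]; as [w k] is lowest in that fibre of [W],
    [X_down] allows adding it. *)
Lemma cone_chain p k u : chain_in p u -> chain_in p.+1 (cone k u).
Proof.
move=> cu T; rewrite /cone; case: ifP => [wT|]; last by rewrite eqxx.
have [->|/cu/andP[/andP[XT cT] TW] _] := eqVneq (u (T :\ w k)) 0.
  by rewrite mulr0 eqxx.
have [t tT tk] := X_meets XT k.
have tW := subsetP TW _ tT.
have ew : fib (w k) = fib t by rewrite fib_w.
have lw : (lev (w k) <= lev t)%N by rewrite -tk lev_w.
have := X_down XT tT ew lw; rewrite setD1K // => XT'.
rewrite /cell XT' addnS (cardsD1 (w k)) wT eqSS cT /=.
by rewrite -(setD1K wT) subUset sub1set w_W.
Qed.

(** Together with [koszul_coneD] this is the homotopy identity: boundary of the cone plus cone of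
    the boundary is the identity, the second term being zero at sets without [w k]. *)
Lemma koszul_cone k u T : w k \notin T -> koszul (cone k u) T = u T.
Proof.
move=> wT; rewrite /koszul (bigD1 (w k)) //= big1 ?addr0.
  by rewrite /cone setU11 setU1K // mulrA incidence_sqr mul1r.
move=> t /andP[tT tw]; rewrite /cone !inE [w k == t]eq_sym (negbTE tw).
by rewrite (negbTE wT) mulr0.
Qed.

Lemma koszul_coneD k u T : w k \in T ->
  koszul (cone k u) T = u T - incidence A (w k) (T :\ w k) * koszul u (T :\ w k).
Proof.
move=> wT; set S := T :\ w k.
have wS : w k \notin S by rewrite !inE eqxx.
have TS : T = w k |: S by rewrite setD1K.
clearbody S.
rewrite [in RHS]/koszul (bigD1 (w k)) //= -TS mulrDr mulrA incidence_sqr mul1r.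
rewrite opprD addrA addrN add0r mulr_sumr -sumrN /koszul TS.
apply: eq_big => [t|t]; first by rewrite !inE negb_or andbC.
rewrite !inE negb_or => /andP[tw tS].
have tU : (t |: (w k |: S)) :\ w k = t |: S.
  by rewrite setUCA setU1K // !inE negb_or eq_sym tw.
rewrite /cone !inE eqxx orbT tU mulrA incidence_anticomm 1?eq_sym //.
by rewrite mulNr mulrA [incidence _ t S * _]mulrC.
Qed.

(* On cycles this is the identity minus a boundary, and it moves the fibre [k] to
   [w k]. *)
Definition retract (k : 'I_n) u T : A := if X T then u T - koszul (cone k u) T else 0.

Lemma retract_chain p k u : chain_in p u -> chain_in p (retract k u).
Proof.
move=> cu T; rewrite /retract; case: ifP => [XT|]; last by rewrite eqxx.
have [->|/cu -> //] := eqVneq (u T) 0.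
rewrite sub0r oppr_eq0 => /koszul_neq0[t tT /(cone_chain cu)].
rewrite /cell XT cardsU1 tT addnS eqSS => /andP[/andP[_ ->]].
by rewrite subUset => /andP[_ ->].
Qed.

(** At sets without [w k] the boundary of the cone gives back [u]. If [T] contains [w k] and another
    element of fibre [k], then [T :\ w k] is in [X], where [u] has zero boundary, so the retract
    vanishes at [T] too. *)
Lemma retract_contracted p (k : 'I_n) u : chain_in p u ->
  (forall T, X T -> koszul u T = 0) ->
  (forall T, u T != 0 -> contracted k T) ->
  forall T, retract k u T != 0 -> contracted k.+1 T.
Proof.
move=> cu zu ku T; rewrite /retract; case: ifP => [XT|]; last by rewrite eqxx.
have [wT|wT] := boolP (w k \in T); last by rewrite koszul_cone // subrr eqxx.
(* Elements of [T] in lower fibres differ from [w k], so they survive in [(t |: T) :\ w k]. *)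
move=> nz; have kT : contracted k T.
  have [u0|/ku //] := eqVneq (u T) 0; move: nz.
  rewrite u0 sub0r oppr_eq0 => /koszul_neq0[t tT]; rewrite /cone setU1r //.
  have [->|/ku kc _] := eqVneq (u ((t |: T) :\ w k)) 0; first by rewrite mulr0 eqxx.
  apply/forall_inP => s sT; apply/implyP => sk.
  have /forall_inP/(_ s) := kc; rewrite !inE sT orbT andbT sk; apply.
  by apply: contraTneq sk => ->; rewrite fib_w ltnn.
apply/forall_inP => s sT; apply/implyP; rewrite ltnS leq_eqVlt => /orP[/eqP sk|sk].
  have {}sk : fib s = k by apply: val_inj.
  apply: contraNT nz; rewrite sk koszul_coneD // => sw.
  rewrite zu ?mulr0 ?subr0 ?subrr //.
  apply: (X_sub XT (subD1set _ _)) => i; have [t tT ti] := X_meets XT i.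
  have [tw|tw] := eqVneq t (w k); last by exists t => //; rewrite !inE tw.
  by exists s; rewrite ?inE ?sw // sk -(fib_w k) -tw.
by have /forall_inP/(_ s sT) := kT; rewrite sk.
Qed.

(** The subtracted term is a boundary, and by [koszul_X_face] the cut-off outside [X] removes
    nothing just above [T]. *)
Lemma koszul_retract p k u T : chain_in p u -> X T ->
  koszul (retract k u) T = koszul u T.
Proof.
move=> cu XT; have cc := cone_chain (k := k) cu.
transitivity (koszul (fun S => u S - koszul (cone k u) S) T); last first.
  by rewrite koszulB koszul_koszul subr0.
apply: eq_koszul => t tT; rewrite /retract; case: ifP => // XtT.
have -> : u (t |: T) = 0.
  by apply: contraFeq XtT => /cu/andP[/andP[]].
suff -> : koszul (cone k u) (t |: T) = 0 by rewrite subr0.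
apply: contraFeq XtT; apply: (koszul_X_face (p := p.+1)) => // S.
by case/cc/andP.
Qed.

Lemma sum_retract k u : chain_in 0 u ->
  \sum_(T | cell 0 T) retract k u T = \sum_(T | cell 0 T) u T.
Proof.
move=> cu; have cc := cone_chain (k := k) cu.
transitivity (\sum_(T | cell 0 T) (u T - koszul (cone k u) T)).
  by apply: eq_bigr => T /andP[XT _]; rewrite /retract XT.
rewrite sumrB sum_koszul_chain1 ?subr0 // => T.
by case/cc/andP.
Qed.

(** A fully contracted cell lies in the image of [w], which has [n] elements; so it equals that
    image and [p = 0]. Its coefficient is then the augmentation of [u]. *)
Lemma contracted_full p u : chain_in p u ->
  (p = 0%N -> \sum_(T | cell 0 T) u T = 0) ->
  (forall T, u T != 0 -> contracted n T) -> forall T, u T = 0.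
Proof.
move=> cu su ku T; apply/eqP; apply: contraT => nzT.
pose Z := w @: [set: 'I_n].
have cZ : #|Z| = n.
  rewrite card_imset ?cardsT ?card_ord // => i j e.
  by rewrite -(fib_w i) e fib_w.
have TZ S : u S != 0 -> S = Z /\ p = 0%N.
  move=> nz; have /andP[/andP[XS /eqP cS] _] := cu _ nz.
  have SZ : S \subset Z.
    apply/subsetP => s sS; have /forall_inP/(_ s sS) := ku _ nz.
    by rewrite ltn_ord => /eqP ->; rewrite imset_f.
  have := subset_leq_card SZ; rewrite cS cZ -[n in (_ <= n)%N]addn0 leq_add2l.
  rewrite leqn0 => /eqP p0; split=> //; apply/eqP.
  by rewrite eqEcard SZ cS cZ leq_addr.
have [eT p0] := TZ _ nzT; move: (su p0).
have cT : cell 0 T by have /andP[] := cu _ nzT; rewrite p0.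
rewrite (bigD1 T) //= big1 ?addr0 => [e|S /andP[_ ST]]; first by rewrite e eqxx in nzT.
by apply: contraNeq ST => /TZ[-> _]; rewrite eT.
Qed.

(** Induction on the number [j] of fibres still to be contracted. *)
Lemma koszul_exact_from p u j k : (k + j = n)%N -> chain_in p u ->
  (forall T, X T -> koszul u T = 0) ->
  (p = 0%N -> \sum_(T | cell 0 T) u T = 0) ->
  (forall T, u T != 0 -> contracted k T) ->
  exists2 g, chain_in p.+1 g & forall T, X T -> koszul g T = u T.
Proof.
elim: j k u => [|j IH] k u kj cu zu su ku.
  rewrite addn0 in kj; exists (fun=> 0) => [T|T _]; first by rewrite eqxx.
  rewrite (contracted_full cu su) -?kj // /koszul big1 // => t _.
  by rewrite mulr0.
have kn : (k < n)%N by rewrite -kj addnS ltnS leq_addr.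
pose k' := Ordinal kn.
have [|||||g cg hg] := IH k.+1 (retract k' u).
- by rewrite addSnnS.
- exact: retract_chain.
- by move=> T XT; rewrite (koszul_retract k' cu) // zu.
- by move=> p0; rewrite p0 in cu; rewrite sum_retract // su.
- exact: (retract_contracted (k := k') cu).
(* On [X], [u] is [retract k' u] plus the boundary of [cone k' u], and [g] bounds the former. *)
exists (fun T => cone k' u T + g T) => [T|T XT].
  have [->|/(cone_chain cu) //] := eqVneq (cone k' u T) 0.
  by rewrite add0r; apply: cg.
by rewrite koszulD hg // /retract XT addrC subrK.
Qed.

End Exactness.

(** With [W] the support of a multidegree, this is acyclicity of the complex in that degree. *)
Lemma koszul_exact W p u : chain_in W p u ->
  (forall T, X T -> koszul u T = 0) ->
  (p = 0%N -> \sum_(T | cell 0 T) u T = 0) ->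
  exists2 g, chain_in W p.+1 g & forall T, X T -> koszul g T = u T.
Proof.
move=> cu zu su.
have [/forallP meets|] := boolP [forall i, [exists t in W, fib t == i]].
  have /fin_all_exists[w hw] i : exists t, [/\ t \in W, fib t = i &
      forall s, s \in W -> fib s = i -> (lev t <= lev s)%N].
    have /existsP[t0 h0] := meets i.
    case: (@arg_minnP V t0 (fun t => (t \in W) && (fib t == i)) lev h0)
      => t /andP[tW /eqP ti] tmin.
    by exists t; split=> // s sW si; apply: tmin; rewrite sW si eqxx.
  apply: (@koszul_exact_from W w _ _ _ p u n 0) => //.
  - by move=> i; have [] := hw i.
  - by move=> i; have [] := hw i.
  - by move=> t tW; have [_ _] := hw (fib t); apply.
  - by move=> T _; apply/forall_inP.
(* Here [W] misses a whole fibre, so it contains no cell and [u] is zero on every set. *)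
rewrite negb_forall => /existsP[i /existsPn h].
exists (fun=> 0) => [T|T _]; first by rewrite eqxx.
have -> : u T = 0.
  apply/eqP; apply: contraT => /cu/andP[/andP[XT _] /subsetP TW].
  have [t tT ti] := X_meets XT i; have := h t.
  by rewrite TW // ti eqxx.
by rewrite /koszul big1 // => t _; rewrite mulr0.
Qed.

End Chains.
End Differential.

(** * The cellular resolution over the polynomial ring *)

Section CellularResolution.
Variables (K : fieldType) (N n : nat) (fib : 'I_N -> 'I_n) (lev : 'I_N -> nat).
Hypothesis fib_lev_inj : forall s t, fib s = fib t -> lev s = lev t -> s = t.
Variable X : pred {set 'I_N}.
Hypothesis X_meets : forall T, X T -> forall i, exists2 t, t \in T & fib t = i.
Hypothesis X_sub : forall S T : {set 'I_N}, X T -> S \subset T ->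
  (forall i, exists2 t, t \in S & fib t = i) -> X S.
Hypothesis X_down : forall (T : {set 'I_N}) t w, X T -> t \in T ->
  fib w = fib t -> (lev w <= lev t)%N -> X (w |: T).

Local Notation S := {mpoly K[N]}.
Local Notation kosz := (koszul fib lev).
Local Notation incid := (incidence fib lev).
Local Notation cellX := (cell n X).
Local Notation chainX := (chain n X).
Implicit Types (T : {set 'I_N}) (u v w : {set 'I_N} -> S).

Definition mset T : 'X_{1..N} := [multinom (t \in T : nat) | t < N].

Lemma mpolyX_mset T : \prod_(t in T) 'X_t = 'X_[mset T] :> S.
Proof.
rewrite mprodXE; congr 'X_[_]; apply/mnmP => i; rewrite mnm_sumE mnmE.
rewrite big_mkcond (bigD1 i) //= big1 ?addn0 => [|j ji].
  by rewrite mnm1E eqxx; case: ifP.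
by rewrite mnm1E (negbTE ji); case: ifP.
Qed.

Lemma msetU1 t T : t \notin T -> mset (t |: T) = (U_(t) + mset T)%MM.
Proof.
move=> tT; apply/mnmP => i; rewrite mnmDE mnm1E !mnmE !inE eq_sym.
by case: eqP => [<-|]; rewrite ?(negbTE tT).
Qed.

Lemma mdeg_mset T : mdeg (mset T) = #|T|.
Proof.
by rewrite mdegE -sum1_card [RHS]big_mkcond; apply: eq_bigr => i _; rewrite mnmE.
Qed.

Definition homogenize v T : S := v T * 'X_[mset T].

Definition cell_diff v T : S :=
  \sum_(t | t \notin T) incid S t T * 'X_t * v (t |: T).

(* Multiplying the [T]-coordinate by x^T makes the differential scalar, so that
   it can be studied one monomial at a time. *)
Lemma homogenize_cell_diff v T : homogenize (cell_diff v) T = kosz (homogenize v) T.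
Proof.
rewrite /homogenize /cell_diff mulr_suml; apply: eq_bigr => t tT.
by rewrite msetU1 // mpolyXD; ring.
Qed.

Lemma homogenize_inj v w T : homogenize v T = homogenize w T -> v T = w T.
Proof.
move=> e; apply/mpolyP => m; rewrite -(mcoeffMX _ (mset T)) -[RHS](mcoeffMX _ (mset T)).
by congr (_@__).
Qed.

Lemma chain_homogenize p v : chainX p v -> chainX p (homogenize v).
Proof.
by move=> cv T; rewrite /homogenize; have [->|/cv] := eqVneq (v T) 0; rewrite ?mul0r ?eqxx.
Qed.

Lemma raddf_koszul (A B : comNzRingType) (f : {additive A -> B})
    (u : {set 'I_N} -> A) T : kosz (fun R => f (u R)) T = f (kosz u T).
Proof.
by rewrite /koszul raddf_sum; apply: eq_bigr => t _; rewrite raddfMsign.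
Qed.

Lemma cell_diff2 v T : cell_diff (cell_diff v) T = 0.
Proof.
apply: (@homogenize_inj _ (fun=> 0)); rewrite homogenize_cell_diff.
rewrite (@eq_koszul _ _ fib lev _ _ (kosz (homogenize v))) ?(koszul_koszul fib_lev_inj).
  by rewrite /homogenize mul0r.
by move=> t _; rewrite homogenize_cell_diff.
Qed.

Lemma koszul_mcoeff_sum d (g : 'X_{1..N < d} -> {set 'I_N} -> K) T :
  kosz (fun R => \sum_m g m R *: 'X_[m] : S) T
    = \sum_m kosz (g m) T *: 'X_[m].
Proof.
rewrite /koszul.
under eq_bigr do rewrite mulr_sumr.
rewrite exchange_big; apply: eq_bigr => m _.
rewrite scaler_suml; apply: eq_bigr => t _.
by rewrite -!mul_mpolyC mpolyCM rmorph_sign mulrA.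
Qed.

(** At each monomial [m], the coefficients of [homogenize v] form a scalar chain on subsets of the
    support of [m]. [koszul_exact] solves each degree, and the solutions are reassembled. *)
Lemma cell_exact p v : chainX p v ->
  (forall T, X T -> cell_diff v T = 0) ->
  (p = 0%N -> \sum_(T | cellX 0 T) homogenize v T = 0) ->
  exists2 w, chainX p.+1 w & forall T, X T -> cell_diff w T = v T.
Proof.
(* [d] exceeds the degree of every monomial that occurs, so finitely many [m] suffice. *)
move=> cv zv sv; pose d := \max_T msize (homogenize v T).
have /fin_all_exists2[g cg hg] (m : 'X_{1..N < d}) :
  exists2 g : {set 'I_N} -> K, chain_in n X [set i | m i != 0%N] p.+1 g
    & forall T, X T -> kosz g T = (homogenize v T)@_m.
- apply: (koszul_exact fib_lev_inj X_meets X_sub X_down) => [T nz|T XT|p0].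
  + have nzv : v T != 0 by apply: contraNneq nz => e; rewrite /homogenize e mul0r mcoeff0.
    rewrite (cv _ nzv) /=; move: nz.
    rewrite -mcoeff_msupp (perm_mem (msuppMX _ _)) => /mapP[m' _ ->].
    by apply/subsetP => i iT; rewrite !inE mnmDE mnmE iT.
  + rewrite (raddf_koszul (mcoeff m)) -homogenize_cell_diff /homogenize zv // mul0r.
    exact: mcoeff0.
  + by rewrite -(raddf_sum (mcoeff m)) sv // raddf0.
(* Exponent subtraction is truncated, but it is exact when [g m T] is nonzero, as [T] then lies in
   the support of [m]. *)
pose w T : S := \sum_m g m T *: 'X_[m - mset T].
have sw T : homogenize w T = \sum_m g m T *: 'X_[m].
  rewrite /homogenize mulr_suml; apply: eq_bigr => m _.
  have [->|/cg/andP[_ /subsetP TW]] := eqVneq (g m T) 0; first by rewrite !scale0r mul0r.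
  rewrite -scalerAl -mpolyXD submK //; apply/mnm_lepP => i; rewrite mnmE.
  by case iT: (i \in T) => //; have := TW _ iT; rewrite inE lt0n.
exists w => [T|T XT].
  move=> nz; have [/existsP[m /cg/andP[]] //|] := boolP [exists m, g m T != 0].
  rewrite negb_exists => /forallP z; case/eqP: nz; apply: big1 => m _.
  by have := z m; rewrite negbK => /eqP ->; rewrite scale0r.
apply: homogenize_inj; rewrite homogenize_cell_diff.
rewrite (@eq_koszul _ _ fib lev _ _ (fun R => \sum_m g m R *: 'X_[m]))
  => [|t _]; last exact: sw.
rewrite koszul_mcoeff_sum [RHS](mpolywE (k := d)).
  by apply: eq_bigr => m _; rewrite hg.
exact: (leq_bigmax (F := fun T => msize (homogenize v T))).
Qed.

Definition cells p : {set {set 'I_N}} := [set T | cellX p T].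

(** Extension by zero to all sets; the sum has at most one term and avoids a membership proof for
    [T]. *)
Definition row_fun p (v : 'rV[S]_#|cells p|) T : S :=
  \sum_(k | enum_val k == T) v ord0 k.

Lemma row_fun_val p (v : 'rV_#|cells p|) k : row_fun v (enum_val k) = v ord0 k.
Proof.
rewrite /row_fun (big_pred1 k) // => l /=.
by rewrite (inj_eq enum_val_inj).
Qed.

Lemma row_fun_chain p (v : 'rV_#|cells p|) : chainX p (row_fun v).
Proof.
move=> T; apply: contraR => cT; rewrite /row_fun big1 // => k /eqP kT.
by have := enum_valP k; rewrite kT inE (negbTE cT).
Qed.

Lemma row_funP p (v : 'rV_#|cells p|) u : chainX p u ->
  (forall k, v ord0 k = u (enum_val k)) -> forall T, row_fun v T = u T.
Proof.
move=> cu e T; have [cT|cT] := boolP (T \in cells p).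
  by rewrite -(enum_rankK_in cT cT) row_fun_val e.
have nc u' : chainX p u' -> u' T = 0.
  by move=> cu'; apply/eqP; apply: contraNT cT => /cu'; rewrite inE.
by rewrite !nc //; apply: row_fun_chain.
Qed.

Definition face_coef (T R : {set 'I_N}) : S :=
  \sum_(t | (t \notin R) && (T == t |: R)) incid S t R * 'X_t.

(** The shift [n + p] is the degree of the squarefree monomial of a [p]-cell, so consecutive shifts
    differ by one and the matrices are linear. *)
Definition cell_seq : graded_free_seq K N :=
  @GradedFreeSeq K N (fun p => #|cells p|) (fun p _ => (n + p)%N)
    (\col_k 'X_[mset (enum_val k)])
    (fun p => \matrix_(k < #|cells p.+1|, l < #|cells p|)
                face_coef (enum_val k) (enum_val l)).

Lemma mulmx_cell_aug (v : 'rV_#|cells 0|) :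
  (v *m gf_aug cell_seq) ord0 ord0 = \sum_(T | cellX 0 T) homogenize (row_fun v) T.
Proof.
rewrite mxE [RHS](eq_bigl (fun T => T \in cells 0)) => [|T]; last by rewrite inE.
by rewrite [RHS]big_enum_val; apply: eq_bigr => k _; rewrite mxE /homogenize row_fun_val.
Qed.

Lemma mulmx_cell_diff p (v : 'rV_#|cells p.+1|) l :
  (v *m gf_diff cell_seq p) ord0 l = cell_diff (row_fun v) (enum_val l).
Proof.
rewrite mxE /cell_diff; under eq_bigr do rewrite mxE /face_coef mulr_sumr.
rewrite (exchange_big_dep (fun t => t \notin enum_val l)) /=;
  last by move=> ? ? _ /andP[].
apply: eq_bigr => t tl; rewrite /row_fun mulr_sumr.
by apply: eq_big => [k|k _]; rewrite ?tl // mulrC.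
Qed.

(** Coordinates exist only for [cells p]. At a set of [X] of another size both sides vanish, since
    no coface has [n + p.+1] elements. *)
Lemma row_fun_cell_diff p (v : 'rV_#|cells p.+1|) T : X T ->
  row_fun (v *m gf_diff cell_seq p) T = cell_diff (row_fun v) T.
Proof.
move=> XT; have [cT|cT] := boolP (cellX p T).
  have cT' : T \in cells p by rewrite inE.
  by rewrite -(enum_rankK_in cT' cT') row_fun_val mulmx_cell_diff.
rewrite (_ : row_fun _ T = 0); last first.
  by apply/eqP; apply: contraNT cT => /row_fun_chain.
rewrite /cell_diff big1 // => t tT.
have [->|/row_fun_chain/andP[_]] := eqVneq (row_fun v (t |: T)) 0.
  by rewrite mulr0.
by rewrite cardsU1 tT addnS eqSS => c; rewrite /cell XT c in cT.
Qed.

Lemma mulmx_cell_diff_eq p (v : 'rV_#|cells p|) (w : 'rV_#|cells p.+1|) :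
  (forall T, X T -> cell_diff (row_fun w) T = row_fun v T) ->
  v = w *m gf_diff cell_seq p.
Proof.
move=> e; apply/rowP => k; rewrite mulmx_cell_diff e ?row_fun_val //.
by have := enum_valP k; rewrite inE => /andP[].
Qed.

Lemma cell_seq_exact p (v : 'rV_#|cells p|) :
  (forall T, X T -> cell_diff (row_fun v) T = 0) ->
  (p = 0%N -> \sum_(T | cellX 0 T) homogenize (row_fun v) T = 0) ->
  exists w : 'rV_#|cells p.+1|, v = w *m gf_diff cell_seq p.
Proof.
move=> zv sv; have [w cw hw] := cell_exact (@row_fun_chain p v) zv sv.
exists (\row_k w (enum_val k)); apply: mulmx_cell_diff_eq => T XT.
rewrite -hw //; apply: eq_bigr => t _; congr (_ * _).
by apply: row_funP => // k; rewrite mxE.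
Qed.

Lemma cell_seq_resolves (J : S -> Prop) :
  (forall q, J q <-> ideal_gen
     (fun q => exists2 T, cellX 0 T & q = \prod_(t in T) 'X_t) q) ->
  gf_resolves cell_seq J.
Proof.
move=> JE; split.
- move=> q; rewrite JE; split=> [[k [c [g [hg ->]]]]|[v <-]].
    have /fin_all_exists2[T cT eT] := hg.
    exists (\row_l \sum_(i | T i == enum_val l) c i); rewrite mxE.
    under eq_bigr do rewrite !mxE mulr_suml.
    rewrite (exchange_big_dep xpredT) //=; apply: eq_bigr => i _.
    have iT : T i \in cells 0 by rewrite inE.
    rewrite (big_pred1 (enum_rank_in iT (T i))) => [|l /=].
      by rewrite enum_rankK_in // eT mpolyX_mset.
    by rewrite -(inj_eq enum_val_inj) enum_rankK_in // eq_sym.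
  exists #|cells 0|, (fun k => v ord0 k), (fun k => 'X_[mset (enum_val k)]).
  split=> [k|]; last by rewrite mxE; apply: eq_bigr => k _; rewrite mxE.
  exists (enum_val k); last by rewrite mpolyX_mset.
  by have := enum_valP k; rewrite inE.
- move=> v; split=> [z|[w ->]].
    apply: cell_seq_exact => [T XT|_]; last by rewrite -mulmx_cell_aug z mxE.
    (* A set of [X] has at least [n] elements, so none of its cofaces is a 0-cell. *)
    apply: big1 => t tT.
    have [->|/row_fun_chain/andP[_]] := eqVneq (row_fun v (t |: T)) 0.
      by rewrite mulr0.
    have := card_X X_meets XT; rewrite cardsU1 tT addn0 add1n => le /eqP e.
    by rewrite -e ltnn in le.
  apply/matrixP => i j; rewrite !ord1 mulmx_cell_aug mxE.
  rewrite -[RHS](sum_koszul_chain1 fib_lev_inj X_meets X_sub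
                  (chain_homogenize (@row_fun_chain 1 w))).
  apply: eq_bigr => T /andP[XT _].
  by rewrite -homogenize_cell_diff /homogenize row_fun_cell_diff.
- move=> p v; split=> [z|[w ->]].
    apply: cell_seq_exact => // T XT.
    by rewrite -row_fun_cell_diff // z /row_fun big1 // => k _; rewrite mxE.
  apply/matrixP => i j; rewrite ord1 mulmx_cell_diff mxE.
  rewrite -[RHS](cell_diff2 (row_fun w) (enum_val j)).
  apply: eq_bigr => t tj; congr (_ * _).
  have Xj : X (enum_val j) by have := enum_valP j; rewrite inE => /andP[].
  have [Xt|Xt] := boolP (X (t |: enum_val j)); first exact: row_fun_cell_diff.
  (* Outside [X] the row has no coordinate, and [koszul_X_face] shows that the untruncated
     differential is zero there as well. *)
  rewrite (_ : row_fun _ _ = 0); last first.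
    by apply/eqP; apply: contraNT Xt => /row_fun_chain/andP[].
  apply/esym/(@homogenize_inj (cell_diff (row_fun w)) (fun=> 0)); rewrite homogenize_cell_diff.
  rewrite (_ : kosz _ _ = 0) ?/homogenize ?mul0r //.
  apply/eqP; apply: contraNT Xt; apply: (koszul_X_face X_meets X_sub) => //.
  exact/chain_homogenize/row_fun_chain.
Qed.

Lemma cell_seq_homogeneous : gf_homogeneous cell_seq.
Proof.
split=> [k|p k l]; rewrite mxE.
  by rewrite dhomogX /= mdeg_mset; have := enum_valP k; rewrite inE => /andP[].
right; exists 1%N => /=; first by rewrite addnS addn1.
apply: rpred_sum => t _; rewrite /incidence -signr_odd mulr_sign.
by case: ifP => _; rewrite ?rpredN dhomogX /= mdeg1.
Qed.

Lemma cell_seq_minimal : gf_minimal cell_seq.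
Proof.
move=> p k l; rewrite /irrelevant_ideal mxE /face_coef.
pose c t := if (t \notin enum_val l) && (enum_val k == t |: enum_val l)
            then incid S t (enum_val l) else 0.
exists N, c, (fun t => 'X_t); split=> [t|]; first by exists t.
by rewrite big_mkcond; apply: eq_bigr => t _; rewrite /c; case: ifP; rewrite ?mul0r.
Qed.

Theorem cells_linear_resolution (J : S -> Prop) :
  (forall q, J q <-> ideal_gen
     (fun q => exists2 T, cellX 0 T & q = \prod_(t in T) 'X_t) q) ->
  has_linear_resolution J.
Proof.
move=> JE; exists n.
  exists (fun q => exists2 T, cellX 0 T & q = \prod_(t in T) 'X_t); split=> // q.
  case=> T /andP[_ cT] ->.
  by rewrite mpolyX_mset dhomogX /= mdeg_mset -[n]addn0.
move=> i k ki; exists cell_seq.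
  split; [exact: cell_seq_homogeneous | exact: cell_seq_resolves
         | exact: cell_seq_minimal].
(* All shifts in place [i] equal [n + i], so no basis element has degree [k]. *)
apply/esym/eqP; rewrite cards_eq0; apply/eqP/setP => l; rewrite !inE.
by apply/eqP => e; apply: ki; rewrite -e addnC.
Qed.

End CellularResolution.

(** * Generated ideals *)

Section IdealGen.
Variable A : comNzRingType.
Implicit Types (G H : A -> Prop) (x : A).

Lemma ideal_gen_mull G a x : ideal_gen G x -> ideal_gen G (a * x).
Proof.
case=> k [c [g [hg ->]]]; exists k, (fun i => a * c i), g; split=> //.
by rewrite mulr_sumr; apply: eq_bigr => i _; rewrite mulrA.
Qed.

Lemma eq_ideal_gen G H x : (forall y, G y <-> H y) ->
  ideal_gen G x <-> ideal_gen H x.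
Proof.
by move=> GH; split=> -[k [c [g [hg ->]]]]; exists k, c, g; split=> // i; apply/GH.
Qed.

End IdealGen.

(** * The cell complex of a monomial ideal *)

Section MonomialIdeal.
Variables (K : fieldType) (n : nat) (I : {mpoly K[n]} -> Prop).
Hypothesis hI : monomial_ideal I.

(** Read contrapositively: the monomials outside [I] are closed under divisibility. *)
Lemma monomial_ideal_le (a b : 'X_{1..n}) :
  (a <= b)%MM -> I 'X_[a] -> I 'X_[b].
Proof.
case: hI => M IE ab; rewrite !IE -(submK ab) mpolyXD.
exact: ideal_gen_mull.
Qed.

Definition wp_fib (t : 'I_(wp_nvars I)) : 'I_n :=
  tag (enum_val t : wp_index I).

(** The variable x_{i,j+1} has level [j], so the levels along a transversal are its exponents
    without a shift. *)
Definition wp_lev (t : 'I_(wp_nvars I)) : nat :=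
  tagged (enum_val t : wp_index I).

Lemma wp_fib_lev_inj s t : wp_fib s = wp_fib t -> wp_lev s = wp_lev t -> s = t.
Proof.
rewrite /wp_fib /wp_lev => e1 e2; apply: enum_val_inj; move: e1 e2.
case: (enum_val s) (enum_val t) => [i x] [j y] /= ij; case: _ / ij y => y.
by move/val_inj ->.
Qed.

Definition wp_of i (j : 'I_(pure_exponent I i)) : 'I_(wp_nvars I) :=
  enum_rank (Tagged (fun i => 'I_(pure_exponent I i)) j : wp_index I).

Lemma wp_fib_of i (j : 'I_(pure_exponent I i)) : wp_fib (wp_of j) = i.
Proof. by rewrite /wp_fib enum_rankK. Qed.

Lemma wp_lev_of i (j : 'I_(pure_exponent I i)) : wp_lev (wp_of j) = j.
Proof. by rewrite /wp_lev enum_rankK. Qed.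

Lemma wp_lev_lt t : (wp_lev t < pure_exponent I (wp_fib t))%N.
Proof. exact: ltn_ord. Qed.

(** Vertices of the product of simplices are encoded by their level vectors [a]. The first clause
    excludes sets with no transversal, for which the second is vacuous. *)
Definition transversals_outside (T : {set 'I_(wp_nvars I)}) : Prop :=
  (forall i, exists2 t, t \in T & wp_fib t = i) /\
  (forall a : 'X_{1..n},
     (forall i, exists2 t, t \in T & wp_fib t = i /\ wp_lev t = a i) ->
     ~ I 'X_[a]).

(** The complex has to be a boolean predicate, while membership in [I] is a proposition; hence the
    classical decision. *)
Definition wp_cell (T : {set 'I_(wp_nvars I)}) : bool :=
  if excluded_middle_informative (transversals_outside T) then true else false.

Lemma wp_cellP T : reflect (transversals_outside T) (wp_cell T).
Proof. by rewrite /wp_cell; case: excluded_middle_informative => h; constructor. Qed.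

Lemma wp_cell_meets T : wp_cell T -> forall i, exists2 t, t \in T & wp_fib t = i.
Proof. by case/wp_cellP. Qed.

Lemma wp_cell_sub (S T : {set 'I_(wp_nvars I)}) : wp_cell T -> S \subset T ->
  (forall i, exists2 t, t \in S & wp_fib t = i) -> wp_cell S.
Proof.
case/wp_cellP => _ hT /subsetP ST hS; apply/wp_cellP; split=> // a ha.
by apply: hT => i; have [t tS e] := ha i; exists t => //; apply: ST.
Qed.

(** A vertex of [w |: T] through [w] divides the vertex of [T] with [t] in place of [w], so it is
    outside [I] as well. *)
Lemma wp_cell_down (T : {set 'I_(wp_nvars I)}) t w : wp_cell T -> t \in T ->
  wp_fib w = wp_fib t -> (wp_lev w <= wp_lev t)%N -> wp_cell (w |: T).
Proof.
case/wp_cellP => mT hT tT wt le; apply/wp_cellP; split=> [i|a ha Ia].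
  by have [s sT si] := mT i; exists s => //; rewrite setU1r.
(* The maximum gives [a <= b] at once; when [a] passes through [w], it equals the level of [t]. *)
pose b := [multinom if i == wp_fib t then maxn (a i) (wp_lev t) else a i | i < n].
have ab : (a <= b)%MM.
  by apply/mnm_lepP => i; rewrite mnmE; case: ifP => // _; rewrite leq_maxl.
(* If [T] attains the level of [a] in this fibre, then [a] is already a vertex of [T]; otherwise [a]
   passes through [w]. *)
have [[s sT [si sa]]|none] := excluded_middle_informative
    (exists2 s, s \in T & wp_fib s = wp_fib t /\ wp_lev s = a (wp_fib t)).
  apply: (hT a) => // i; have [->|it] := eqVneq i (wp_fib t); first by exists s.
  have [r] := ha i; rewrite !inE => /orP[/eqP -> [wi]|rT e]; last by exists r.
  by rewrite -wi wt eqxx in it.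
apply: (hT b); last exact: monomial_ideal_le Ia.
move=> i; rewrite mnmE; have [->|it] := eqVneq i (wp_fib t).
  exists t => //; split=> //; apply/esym/maxn_idPr.
  have [r] := ha (wp_fib t); rewrite !inE => /orP[/eqP -> [_ <-] //|rT e].
  by case: none; exists r.
have [r] := ha i; rewrite !inE => /orP[/eqP -> [wi]|rT e]; last by exists r.
by rewrite -wi wt eqxx in it.
Qed.

(** A 0-cell has one element in each fibre, hence a single transversal [a]; the product of its
    variables is the generator of [L_ideal I] attached to [a]. *)
Lemma L_ideal_gen q : L_ideal I q <-> ideal_gen
  (fun q => exists2 T, cell n wp_cell 0 T & q = \prod_(t in T) 'X_t) q.
Proof.
apply: eq_ideal_gen => {}q; split=> [[a [lt_ab [Ia ->]]]|[T cT ->]].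
  pose f i := wp_of (Ordinal (lt_ab i)).
  have f_inj : injective f.
    by move=> i j e; rewrite -(wp_fib_of (Ordinal (lt_ab i))) -/(f i) e wp_fib_of.
  exists (f @: [set: 'I_n]).
    rewrite /cell card_imset // cardsT card_ord addn0 eqxx andbT.
    apply/wp_cellP; split=> [i|b hb].
      by exists (f i); rewrite ?imset_f ?wp_fib_of.
    suff <- : a = b by [].
    apply/mnmP => i; have [t /imsetP[j _ ->] []] := hb i.
    by rewrite wp_fib_of wp_lev_of => ->.
  rewrite big_imset /=; last by move=> i j _ _; apply: f_inj.
  by apply: eq_bigl => i; rewrite inE.
have inj := cell0_inj wp_cell_meets cT.
case/andP: cT => /wp_cellP[mT hT] _.
have /fin_all_exists2[f fT ff] := mT.
pose a : 'X_{1..n} := [multinom wp_lev (f i) | i < n].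
have lt_ab i : (a i < pure_exponent I i)%N.
  by rewrite mnmE -{2}(ff i) wp_lev_lt.
have fE i : f i = wp_of (Ordinal (lt_ab i)).
  by apply: wp_fib_lev_inj; rewrite ?wp_fib_of ?wp_lev_of //= mnmE.
exists a, lt_ab; split.
  by apply: hT => i; exists (f i) => //; rewrite mnmE.
have -> : T = f @: [set: 'I_n].
  apply/setP => t; apply/idP/imsetP => [tT|[i _ ->] //].
  by exists (wp_fib t) => //; apply: inj; rewrite ?ff.
rewrite big_imset /=; last by move=> i j _ _ e; rewrite -(ff i) e ff.
by apply: eq_big => [i|i _]; rewrite ?inE // fE.
Qed.

End MonomialIdeal.

Theorem corollary1p3 (K : fieldType) (n : nat) (I : {mpoly K[n]} -> Prop)
  (hI : monomial_ideal I) (hdim : quotient_krull_dim I 0) :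
  has_linear_resolution (L_ideal I).
Proof.
apply: (cells_linear_resolution (@wp_fib_lev_inj K n I) (@wp_cell_meets K n I)
  (@wp_cell_sub K n I) (wp_cell_down hI)).
exact: L_ideal_gen.
Qed.
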